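(* Let $n \ge 3$ be an integer and let $A^{(n)}$ be the $n\times n$ real matrix with entries $$A^{(n)}_{ij} = \begin{cases} 1, & \text{if } -2 \le j-i \le 1,\\ 1, & \text{if } (i,j)=(1,n),\\ 0, & \text{otherwise},\end{cases}$$ and let $A_n=\det A^{(n)}$. Then $$A_n=\begin{cases} 1, & n\equiv 0 \pmod 4,\\ 2, & n\equiv 1 \pmod 4,\\ -1, & n\equiv 2 \pmod 4,\\ 0, & n\equiv 3 \pmod 4.\end{cases}$$
   Context: $A^{(n)}$ is the Toeplitz matrix whose first superdiagonal, main diagonal and first two subdiagonals consist of ones, with an additional entry $1$ in the top-right corner $(1,n)$, and zeros elsewhere. *)

(* Defs.v *)
From HB Require Import structures.
From mathcomp Require Import all_boot all_order all_algebra.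
From mathcomp Require Import reals.

Set Implicit Arguments.
Unset Strict Implicit.
Unset Printing Implicit Defensive.

Import Order.TTheory GRing.Theory Num.Theory.
Local Open Scope ring_scope.

(* Indices i, j : 'I_n start at 0: the difference j - i (taken in int) is
   unaffected, and the top-right corner (1, n) is i = 0, j + 1 = n. *)
Definition corner_toeplitz (R : realType) (n : nat) : 'M[R]_n :=
  \matrix_(i < n, j < n)
    if (- 2%:Z <= (j : nat)%:Z - (i : nat)%:Z <= 1%:Z)
       || ((i == 0 :> nat) && (j.+1 == n :> nat))
    then 1 else 0.

(* Main.v *)
Require Import Defs.
From HB Require Import structures.
From mathcomp Require Import all_boot all_order all_algebra.
From mathcomp Require Import reals.
From mathcomp Require Import zify ring.

Set Implicit Arguments.
Unset Strict Implicit.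
Unset Printing Implicit Defensive.

Import Order.TTheory GRing.Theory Num.Theory.
Local Open Scope ring_scope.

(* Let T_n be the matrix without the corner entry and t_n = det T_n.  Expanding
   along the first row, the corner contributes (-1)^(n-1) times the minor
   obtained by deleting the first row and the last column, which is the
   transpose of T_(n-1); so A_n = t_n + (-1)^(n-1) t_(n-1).  Moreover adding
   column 0 to column 4 of T_(n+4) and subtracting column 1 makes T_(n+4) block
   lower triangular with diagonal blocks T_4 and T_n.  As det T_4 = 1, t_n is
   4-periodic, with values 1, 1, 0, 0. *)

Definition band_toeplitz (R : comNzRingType) (n : nat) : 'M[R]_n :=
  \matrix_(i < n, j < n) ((j <= i.+1)%N && (i <= j.+2)%N)%:R.

Lemma det_band_toeplitz0 (R : comNzRingType) : \det (band_toeplitz R 0) = 1.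
Proof. exact: det_mx00. Qed.

Lemma det_band_toeplitz1 (R : comNzRingType) : \det (band_toeplitz R 1) = 1.
Proof. by rewrite det_mx11 mxE. Qed.

Lemma det_band_toeplitz2 (R : comNzRingType) : \det (band_toeplitz R 2) = 0.
Proof.
apply: (@determinant_alternate _ _ _ ord0 ord_max) => // j.
by rewrite !mxE; case: j => [[|[|]]].
Qed.

Lemma det_band_toeplitz3 (R : comNzRingType) : \det (band_toeplitz R 3) = 0.
Proof.
(* The last two rows of T_3 consist of ones only. *)
apply: (@determinant_alternate _ _ _ (lift ord0 ord0) ord_max) => // j.
by rewrite !mxE; case: j => [[|[|[|]]]].
Qed.

Lemma det_band_toeplitz4 (R : comNzRingType) : \det (band_toeplitz R 4) = 1.
Proof.
rewrite (expand_det_row _ ord0) !big_ord_recl big_ord0 /cofactor.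
do 2 rewrite !(expand_det_row _ ord0) !big_ord_recl !big_ord0 /cofactor.
rewrite !det_mx11 !mxE /= /bump /=.
ring.
Qed.

Lemma det_band_toeplitzD4 (R : comNzRingType) (n : nat) :
  \det (band_toeplitz R (4 + n)) = \det (band_toeplitz R n).
Proof.
pose T := band_toeplitz R (4 + n).
(* Column 0 has its ones in rows 0 to 2 and column 1 in rows 0 to 3, so their difference is -1 in
   row 3 and 0 elsewhere. This cancels the entry (3, 4), the only one of the upper right block
   inside the band. *)
pose X : 'M[R]_(4, n) :=
  \matrix_(i < 4, j < n) ((j == 0 :> nat)%:R * ((i == 0 :> nat)%:R - (i == 1 :> nat)%:R)).
have TX : T *m block_mx 1%:M X 0 1%:M
          = block_mx (band_toeplitz R 4) 0 (dlsubmx T) (band_toeplitz R n).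
  rewrite -[T in LHS]submxK mulmx_block !mulmx1 !mulmx0 !addr0; congr block_mx.
  - by apply/matrixP => i j; rewrite !mxE.
  - apply/matrixP => i j; rewrite !mxE !big_ord_recl big_ord0 !mxE /= /bump /=.
    by case: i => [[|[|[|[|]]]]] // ?; case: j => [[|j]] ? /=; ring.
  (* Columns 0 and 1 vanish below row 3, so the lower right block is unchanged; shifting both
     indices by 4 preserves the band. *)
  - apply/matrixP => i j; rewrite !mxE !big_ord_recl big_ord0 !mxE /= /bump /=.
    have -> : ((4 + j <= (4 + i).+1) && (4 + i <= (4 + j).+2))%N
              = ((j <= i.+1) && (i <= j.+2))%N by lia.
    by rewrite !add4n /=; ring.
move/(congr1 determinant): TX.
by rewrite det_mulmx det_ublock det_lblock !det1 !mulr1 det_band_toeplitz4 mul1r.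
Qed.

Lemma det_band_toeplitz (R : comNzRingType) (n : nat) :
  \det (band_toeplitz R n) = (n %% 4 < 2)%N%:R.
Proof.
elim/ltn_ind: n => -[|[|[|[|n]]]] IHn.
- exact: det_band_toeplitz0.
- exact: det_band_toeplitz1.
- exact: det_band_toeplitz2.
- exact: det_band_toeplitz3.
by rewrite (det_band_toeplitzD4 R n) IHn ?modnDl //; lia.
Qed.

Lemma det_corner_toeplitz (R : realType) (m : nat) (hm : (2 <= m)%N) :
  \det (corner_toeplitz R m.+1)
  = \det (band_toeplitz R m.+1) + (-1) ^+ m * \det (band_toeplitz R m).
Proof.
have bandE (a b : nat) : (- 2%:Z <= b%:Z - a%:Z <= 1%:Z) = ((b <= a.+1)%N && (a <= b.+2)%N).
  by lia.
have rowE (j : 'I_m.+1) : corner_toeplitz R m.+1 ord0 j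
    = band_toeplitz R m.+1 ord0 j + (j == ord_max)%:R.
  rewrite !mxE bandE -val_eqE /= eqSS andbT.
  case: (eqVneq (j : nat) m) => [->|_]; rewrite ?orbT ?orbF.
    (* By [hm] the corner lies outside the band, so the sum there is 0 + 1. *)
    by rewrite [(m <= 1)%N]leqNgt hm add0r.
  by rewrite addr0; case: (j <= 1)%N.
have cofE (j : 'I_m.+1) :
    cofactor (corner_toeplitz R m.+1) ord0 j = cofactor (band_toeplitz R m.+1) ord0 j.
  (* Deleting row 0 removes the corner entry. *)
  congr (_ * \det _); apply/matrixP => i k; rewrite !mxE bandE /= orbF.
  by case: (_ && _).
rewrite !(expand_det_row _ ord0).
under eq_bigr => j _ do rewrite rowE cofE mulrDl.
rewrite big_split /=; congr (_ + _).
rewrite (bigD1 ord_max) //= big1 ?addr0 => [|j /negPf->]; last by rewrite mul0r.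
rewrite eqxx mul1r /cofactor add0n -[in RHS]det_tr; congr (_ * \det _).
(* Row i of the minor is row i + 1 of the band matrix, so its band reads j <= i + 2 and i <= j + 1,
   with the roles of i and j exchanged. *)
apply/matrixP => i j; rewrite !mxE /= /bump leq0n.
have -> : (m <= j)%N = false by have := ltn_ord j; lia.
by congr (_%:R); rewrite add0n add1n andbC; lia.
Qed.

Theorem theorem1 (R : realType) (n : nat) (hn : (3 <= n)%N) :
  [/\ (n = 0 %[mod 4])%N -> \det (corner_toeplitz R n) = 1,
      (n = 1 %[mod 4])%N -> \det (corner_toeplitz R n) = 2%:R,
      (n = 2 %[mod 4])%N -> \det (corner_toeplitz R n) = - 1
    & (n = 3 %[mod 4])%N -> \det (corner_toeplitz R n) = 0].
Proof.
case: n hn => // m hm.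
(* Reducing the sign to the parity of [m] makes both terms depend only on n mod 4. *)
rewrite det_corner_toeplitz // !det_band_toeplitz -signr_odd.
split=> mE.
- have [-> -> ->] : [/\ m.+1 %% 4 = 0, m %% 4 = 3 & odd m]%N by split; lia.
  by rewrite mulr0 addr0.
- have [-> -> ->] : [/\ m.+1 %% 4 = 1, m %% 4 = 0 & odd m = false]%N by split; lia.
  by rewrite mul1r.
- have [-> -> ->] : [/\ m.+1 %% 4 = 2, m %% 4 = 1 & odd m]%N by split; lia.
  by rewrite mulr1 add0r.
- have [-> ->] : (m.+1 %% 4 = 3 /\ m %% 4 = 2)%N by split; lia.
  by rewrite mulr0 addr0.
Qed.
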